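(* Let $k\ge1$ be an integer and $G$ a finite group. Then $$1+\sum_{n\ge1}\chi^{(k)}({\rm pt},G_n)\,t^n=\left(\prod_{r_1,\dots,r_k\ge1}\left(1-t^{r_1r_2\cdots r_k}\right)^{r_2r_3^2\cdots r_k^{k-1}}\right)^{-\chi^{(k)}({\rm pt},G)},$$ where $\chi^{(k)}({\rm pt},G)=\frac{1}{|G|}\,|{\rm Hom}(\mathbb Z^{k+1},G)|$ (i.e. $1/|G|$ times the number of $(k+1)$-tuples of pairwise commuting elements of $G$) and similarly $\chi^{(k)}({\rm pt},G_n)=\frac1{|G_n|}|{\rm Hom}(\mathbb Z^{k+1},G_n)|$.
   Context: $G_n=G\wr S_n=G^n\rtimes S_n$ is the wreath product with multiplication $((g_1,\dots,g_n),s)((g'_1,\dots,g'_n),s')=((g_1g'_{s^{-1}(1)},\dots,g_ng'_{s^{-1}(n)}),ss')$, of order $|G|^n n!$. For $f\in1+t\mathbb Q[[t]]$ and $c\in\mathbb Q$, $f^c=\exp(c\log f)$; the infinite product converges $t$-adically. *)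

(* Defs.v *)
From HB Require Import structures.
From mathcomp Require Import all_boot all_order all_algebra all_fingroup.
Set Implicit Arguments. Unset Strict Implicit. Unset Printing Implicit Defensive.
Import Order.TTheory GRing.Theory Num.Theory.
Local Open Scope ring_scope.

Definition series := nat -> rat.

Definition sone : series := fun n => (n == 0)%:R.

Definition smul (f g : series) : series :=
  fun n => \sum_(i < n.+1) f i * g (n - i)%N.

Definition spow (f : series) (j : nat) : series := iter j (smul f) sone.

Definition sdrop0 (f : series) : series := fun n => if n == 0%N then 0 else f n.

(* log f = sum_{j>=1} (-1)^(j+1) (f-1)^j / j  for f in 1 + tQ[[t]];
   (f-1)^j only contributes to coefficients >= j, so the t-adic sum is
   computed coefficientwise by a finite sum. *)
Definition slog (f : series) : series :=
  fun n => \sum_(1 <= j < n.+1) ((-1) ^+ j.+1 / j%:R) * spow (sdrop0 f) j n.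

Definition sexp (h : series) : series :=
  fun n => \sum_(j < n.+1) spow (sdrop0 h) j n / (j`!)%:R.

Definition fpow (c : rat) (f : series) : series :=
  sexp (fun n => c * slog f n).

Definition one_minus_tpow (m : nat) : series :=
  fun n => (n == 0%N)%:R - (n == m)%:R.

Definition partial_prod (k M : nat) : series :=
  \big[smul/sone]_(r : {ffun 'I_k -> 'I_M})
     spow (one_minus_tpow (\prod_(i < k) (r i).+1)%N)
          (\prod_(i < k) (r i).+1 ^ i)%N.

Definition chiG (gT : finGroupType) (k : nat) : rat :=
  (#|[set x : {ffun 'I_k.+1 -> gT} |
        [forall i, forall j, (x i * x j == x j * x i)%g]]|)%:R / (#|gT|)%:R.

Definition wreath (gT : finGroupType) (n : nat) : finType :=
  ({ffun 'I_n -> gT} * {perm 'I_n})%type.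

(* ((g_i),s)((g'_i),s') = ((g_i g'_{s^{-1}(i)}), s o s') ;
   in mathcomp (s' * s)%g is the permutation x |-> s (s' x). *)
Definition wmul (gT : finGroupType) (n : nat) (x y : wreath gT n) : wreath gT n :=
  ([ffun i => (x.1 i * y.1 ((x.2)^-1%g i))%g], (y.2 * x.2)%g).

Definition chiGn (gT : finGroupType) (k n : nat) : rat :=
  (#|[set x : {ffun 'I_k.+1 -> wreath gT n} |
        [forall i, forall j, wmul (x i) (x j) == wmul (x j) (x i)]]|)%:R
  / ((#|gT| ^ n * n`!)%N)%:R.

Definition lhs_series (gT : finGroupType) (k : nat) : series :=
  fun n => if n == 0%N then 1 else chiGn gT k n.

(* Main.v *)
Require Import Defs.
From mathcomp Require Import all_boot all_order all_algebra all_fingroup.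
From mathcomp Require Import zify ring.
From Stdlib Require Import FunctionalExtensionality.
Set Implicit Arguments. Unset Strict Implicit. Unset Printing Implicit Defensive.

(* Let h(n) be the number of commuting (k+1)-tuples in the wreath product G_n,
   seen as the automorphism group of the free right G-set {1..n} x G. The orbit
   of a point under such a tuple and G is classified by the stabiliser of the
   point in Z^(k+1) x G, i.e. by a sublattice of Z^(k+1) in Hermite normal form,
   of index d say, together with a commuting tuple of holonomies in G. A model
   of index d embeds in n^_d |G|^d ways, and the tuple is then arbitrary on the
   n - d remaining points, so that counting pairs (tuple, point) gives
     n |G| h(n) = sum_d j(d) |Hom(Z^(k+1), G)| n^_d |G|^d h(n - d),
   where j(d) is the number of sublattices of index d in Z^(k+1). Hence the
   logarithmic derivative t F'/F of the left-hand side is chi * sum_d j(d) t^d.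
   That of the product is - sum_d j(d) t^d, because the Hermite normal forms
   with diagonal r_0, ..., r_k number r_1 r_2^2 ... r_k^k, and for c in Q the
   power f^c has logarithmic derivative c t f'/f. *)

(** * Systems of commuting maps and Hermite normal forms *)

(* A list [s] of naturals encodes the diagonal [r_i = s_i + 1] of a Hermite
   normal form; [box s] is its fundamental domain, and [lab s] the set of all
   possible off-diagonal parts. *)
Fixpoint box (s : seq nat) : finType :=
  if s is r :: s' then (box s' * 'I_r.+1)%type else unit.

Fixpoint lab (s : seq nat) : finType :=
  if s is r :: s' then (lab s' * box s')%type else unit.

Fixpoint box0 (s : seq nat) : box s :=
  if s is r :: s' return box s then (box0 s', ord0) else tt.

Definition shift (T : Type) (x : nat -> T) (i : nat) := x i.+1.

(* [eval x p a] is the image of [p] under the word [x_0^(a_0) x_1^(a_1) ...]. *)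
Fixpoint eval (Y : Type) (s : seq nat) (x : nat -> Y -> Y) (p : Y) : box s -> Y :=
  match s return box s -> Y with
  | [::] => fun _ => p
  | r :: s' => fun a => iter a.2 (x 0) (@eval Y s' (shift x) p a.1)
  end.

Section Eval.
Variables (Y Z : Type).

Lemma iter_morph (f : Y -> Z) (g : Y -> Y) (h : Z -> Z) j y :
  (forall y, f (g y) = h (f y)) -> f (iter j g y) = iter j h (f y).
Proof. by move=> H; elim: j => //= j <-; rewrite H. Qed.

Lemma eval_morph (f : Y -> Z) s (x : nat -> Y -> Y) (z : nat -> Z -> Z) p a :
  (forall i y, i < size s -> f (x i y) = z i (f y)) ->
  f (@eval Y s x p a) = @eval Z s z (f p) a.
Proof.
elim: s x z a => [|r s IH] x z a //= H.
rewrite (iter_morph (h := z 0)); last by move=> y; apply: H.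
by congr iter; apply: IH => i y; apply: (H i.+1).
Qed.

Lemma eval_inj s (x : nat -> Y -> Y) a :
  (forall i, i < size s -> injective (x i)) -> injective (fun p => @eval Y s x p a).
Proof.
elim: s x a => [|r s IH] x a /= H p q; first by [].

have Hi j : injective (iter j (x 0)).
  by elim: j => //= j IHj u v /(H 0 isT)/IHj.
by move/Hi; apply: IH => i Hs; apply: (H i.+1).
Qed.

End Eval.

Lemma eval_box0 (Y : Type) s (x : nat -> Y -> Y) p : @eval Y s x p (box0 s) = p.
Proof. by elim: s x => //= r s IH x; apply: IH. Qed.

(** An injective self-map of a finite set that sends [S] into itself permutes [S], so each letter of
    the word can be undone. *)
Lemma eval_stable_inv (Y : finType) s (x : nat -> Y -> Y) (S : {set Y}) p a :
  (forall i, i < size s -> injective (x i)) ->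
  (forall i y, i < size s -> y \in S -> x i y \in S) ->
  @eval Y s x p a \in S -> p \in S.
Proof.
have inv (f : Y -> Y) y : injective f -> (forall y, y \in S -> f y \in S) ->
    f y \in S -> y \in S.
  move=> fI fS.
  have e : f @: S = S.
    apply/eqP; rewrite eqEcard card_imset // leqnn andbT.
    by apply/subsetP=> _ /imsetP[u uS ->]; apply: fS.
  by rewrite -{1}e mem_imset.
elim: s x a => [|r s IH] x a //= xI xS.
have it j y : iter j (x 0) y \in S -> y \in S.
  elim: j => //= j IHj H; apply: IHj; apply: (inv (x 0)) H; first exact: xI.
  by move=> u; apply: xS.
move/it; apply: IH => [i Hi|i y Hi]; [exact: (xI i.+1)|exact: (xS i.+1)].
Qed.

Section FreeSets.
Variable gT : finGroupType.
Local Open Scope group_scope.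

(** [I * gT] is the free right [gT]-set with orbit set [I]; the first component of a point names its
    orbit. *)
Definition rmul (I : Type) (y : I * gT) (h : gT) : I * gT := (y.1, y.2 * h).

Definition equivariant (I J : Type) (f : I * gT -> J * gT) :=
  forall y h, f (rmul y h) = rmul (f y) h.

Lemma rmulA I (y : I * gT) g h : rmul (rmul y g) h = rmul y (g * h).
Proof. by rewrite /rmul /= mulgA. Qed.

Lemma rmul1 I (y : I * gT) : rmul y 1 = y.
Proof. by case: y => i g; rewrite /rmul /= mulg1. Qed.

Lemma rmul_inj I (y : I * gT) : injective (rmul y).
Proof. by move=> g h [] /mulgI. Qed.

Lemma eq_fst_rmul I (y z : I * gT) : y.1 = z.1 -> y = rmul z (z.2^-1 * y.2).
Proof. by case: y z => [i g] [j h] /= ->; rewrite /rmul /= mulKVg. Qed.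

(* The pointed transitive system with Hermite data [s], [l] and holonomy [c]:
   the last coordinate is shifted, and when it overflows it is reset while the
   word encoded by [l] and the left translation by [c 0] are applied. *)
Fixpoint model (s : seq nat) :
    lab s -> (nat -> gT) -> nat -> box s * gT -> box s * gT :=
  match s return lab s -> (nat -> gT) -> nat -> box s * gT -> box s * gT with
  | [::] => fun _ _ _ y => y
  | r :: s' => fun l c i y =>
    if i is i'.+1 then
      let z := @model s' l.1 (shift c) i' (y.1.1, y.2) in ((z.1, y.1.2), z.2)
    else if y.1.2 < r then ((y.1.1, inord y.1.2.+1), y.2)
    else let z := @eval _ s' (@model s' l.1 (shift c)) (y.1.1, c 0 * y.2) l.2 in
      ((z.1, ord0), z.2)
  end.

(* [r + 1] is the first return time of [p] under [x 0] to the orbit of [p]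
   under the remaining generators and [gT], and the return point is
   [eval _ p l.2] times [c 0]. *)
Fixpoint hermite (I : finType) (s : seq nat) (x : nat -> I * gT -> I * gT)
    (p : I * gT) : lab s -> (nat -> gT) -> bool :=
  match s return lab s -> (nat -> gT) -> bool with
  | [::] => fun _ _ => true
  | r :: s' => fun l c =>
    @hermite I s' (shift x) p l.1 (shift c) &&
    ((iter r.+1 (x 0) p == rmul (@eval _ s' (shift x) p l.2) (c 0)) &&
     [forall j : 'I_r.+1, (0 < j) ==>
       ((iter j (x 0) p).1 \notin codom (fun a => (@eval _ s' (shift x) p a).1))])
  end.

Definition emb (I B : Type) (f : B -> I * gT) (y : B * gT) : I * gT := rmul (f y.1) y.2.

Lemma model_equivariant s l c i : equivariant (@model s l c i).
Proof.
elim: s l c i => [|r s IH] l c i //= y h.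
case: i => [|i] /=; last first.
  by have := IH l.1 (shift c) i (y.1.1, y.2) h; rewrite /rmul /= => ->.
case: ifP => // _.
have := eval_morph (f := fun y => rmul y h) (x := model l.1 (shift c))
  (z := model l.1 (shift c)) (s := s) (y.1.1, c 0%N * y.2) l.2 _.
rewrite /rmul /= mulgA => <- //= i z _.
by have := IH l.1 (shift c) i z h.
Qed.

(** The model only uses left translations by the [c j], so left translation by [h] passes through
    it. With [h] equal to [c 0] this settles the overflow case of [model_comm]. *)
Lemma model_lmul s l c i h y : (forall j, commute h (c j)) ->
  @model s l c i (y.1, h * y.2) =
    ((@model s l c i y).1, h * (@model s l c i y).2).
Proof.
elim: s l c i y => [|r s IH] l c i y //= hc.
case: i => [|i] /=; last first.
  by have /= -> := IH l.1 (shift c) i (y.1.1, y.2) (fun j => hc j.+1).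
case: ifP => // _.
have := eval_morph (f := fun y : box s * gT => (y.1, h * y.2))
  (x := model l.1 (shift c))
  (z := model l.1 (shift c)) (s := s) (y.1.1, c 0%N * y.2) l.2 _.
rewrite /= !mulgA (hc 0%N) => <- //= i z _.
by rewrite -(IH l.1 (shift c) i) // => j; apply: hc.
Qed.

Lemma model_comm s l c i j y : (forall i j, commute (c i) (c j)) ->
  @model s l c i (@model s l c j y) = @model s l c j (@model s l c i y).
Proof.
elim: s l c i j y => [|r s IH] l c i j y //= cc.
have cc' : forall i j, commute (shift c i) (shift c j) by move=> *; apply: cc.
have main k : @model (r :: s) l c 0 (@model (r :: s) l c k.+1 y) =
    @model (r :: s) l c k.+1 (@model (r :: s) l c 0 y).
  rewrite /=; case: ifP => // _ /=; rewrite -surjective_pairing.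
  have -> := eval_morph (f := model l.1 (shift c) k)
    (x := model l.1 (shift c))
    (z := model l.1 (shift c)) (s := s) (y.1.1, c 0%N * y.2) l.2 _ ; last first.
    by move=> i' z _; apply: IH.
  have -> // := @model_lmul s l.1 (shift c) k (c 0%N) (y.1.1, y.2).
  by move=> j'; apply: cc.
case: i j => [|i] [|j]; [by []|exact: main|by symmetry; apply: main|].
by rewrite /= -!surjective_pairing IH.
Qed.

Lemma model_inj s l c i : injective (@model s l c i).
Proof.
elim: s l c i => [|r s IH] l c i // [[a j] g] [[a' j'] g'] /=.
case: i => [|i] /=; last first.
  case=> e1 -> e2; suff [-> -> //] : (a, g) = (a', g').
  by apply: (IH l.1 (shift c) i); rewrite [LHS]surjective_pairing [RHS]surjective_pairing e1 e2.
have jr := ltn_ord j; have jr' := ltn_ord j'.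
case: ifP => H; case: ifP => H'.
- move=> [-> /(congr1 val)]; rewrite /= !inordK // => -[e] ->.
  by rewrite (val_inj e).
- by move=> [_ /(congr1 val)]; rewrite /= !inordK.
- by move=> [_ /(congr1 val)]; rewrite /= !inordK.
move=> [e1 e2].
have : (a, c 0%N * g) = (a', c 0%N * g').
  apply: (@eval_inj _ s (model l.1 (shift c)) l.2); first by move=> *; apply: IH.
  by rewrite [LHS]surjective_pairing [RHS]surjective_pairing e1 e2.
case=> -> /mulgI ->; congr ((_, _), _); apply: val_inj => /=; lia.
Qed.

Lemma iter_model r s l c j a g : j <= r ->
  iter j (@model (r :: s) l c 0) ((a, ord0), g) = ((a, inord j), g).
Proof.
elim: j => [|j IH] jr /=; first by congr ((_, _), _); apply: val_inj; rewrite /= inordK.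
have jr' : j < r.+1 by exact: ltnW.
by rewrite IH /= ?inordK ?jr // ltnW.
Qed.

(** A point of [box s] is the exponent vector of the word that reaches it from the origin; no
    overflow occurs on the way. *)
Lemma eval_model s l c a g : @eval _ s (@model s l c) (box0 s, g) a = (a, g).
Proof.
elim: s l c a g => [|r s IH] l c [] //= a j g.
have <- := eval_morph (f := fun y : box s * gT => ((y.1, @ord0 r), y.2))
  (x := model l.1 (shift c))
  (z := shift (@model (r :: s) l c)) (s := s) (box0 s, g) a _; last by move=> i [].
rewrite IH /= (iter_model l c a g) ?inord_val //.
by rewrite -ltnS ltn_ord.
Qed.

Section Hermite.
Variable I : finType.
Implicit Types (x : nat -> I * gT -> I * gT) (p : I * gT).

Lemma emb_eval_equiv s x a h p : (forall i, equivariant (x i)) ->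
  @eval _ s x (rmul p h) a = rmul (@eval _ s x p a) h.
Proof.
move=> xE; rewrite (eval_morph (f := fun y => rmul y h) (z := x)) // => i y _.
by rewrite xE.
Qed.

Lemma iter_equiv (f : I * gT -> I * gT) j : equivariant f -> equivariant (iter j f).
Proof. by move=> fE y h; elim: j => //= j ->. Qed.

Lemma emb_equiv (B : Type) (f : B -> I * gT) : equivariant (emb f).
Proof. by move=> y h; rewrite /emb rmulA. Qed.

(** At an overflow, the return relation that [hermite] imposes on [p] is exactly the reset rule of
    [model]; the other cases follow by commutation and induction. *)
Lemma hermite_morph s x p l c i y :
  (forall i, equivariant (x i)) -> (forall i j y, x i (x j y) = x j (x i y)) ->
  @hermite I s x p l c -> i < size s ->
  emb (@eval _ s x p) (@model s l c i y) = x i (emb (@eval _ s x p) y).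
Proof.
elim: s x l c i y => [|r s IH] x l c i [[a j] g] //= xE xC /and3P[Hh /eqP Hr _].
have xE' k : equivariant (shift x k) by apply: xE.
have xC' k k' z : shift x k (shift x k' z) = shift x k' (shift x k z) by apply: xC.
have {}IH := IH (shift x) l.1 (shift c) _ _ xE' xC' Hh.
case: i => [|i] si /=; last first.
  rewrite /emb /= xE (@iter_morph _ _ (x i.+1) (x 0%N) (x 0%N)); last by move=> z; apply: xC.
  have := IH i (a, g) si; rewrite /emb /= xE' => IHi.
  by rewrite -!iter_equiv // IHi -xE'.
case: ifP => jr /=.
  rewrite /emb /= inordK // xE //=.
rewrite /emb /= xE -[x 0%N (iter _ _ _)]/(iter j.+1 (x 0%N) _).
have -> : j.+1 = r.+1 by have := ltn_ord j; lia.
rewrite (eval_morph (f := iter r.+1 (x 0%N)) (z := shift x)); last first.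
  by move=> i z _; symmetry; apply: iter_morph => w; apply: xC.
rewrite [iter _ _ p]Hr emb_eval_equiv // rmulA.
rewrite (eval_morph (f := fun q => eval (s := s) (shift x) q a)
  (x := shift x) (z := shift x)); last first.
  by move=> i z _; symmetry; apply: eval_morph => k w _; apply: xC'.
rewrite /= -[RHS]emb_eval_equiv //.
rewrite -[rmul (eval _ _ a) _]/(emb (eval (s := s) (shift x) p) (a, c 0%N * g)).
rewrite -(eval_morph (f := emb (eval (s := s) (shift x) p)) (x := model l.1 (shift c))) //.
Qed.

(** If words with exponents [j <= j'] of [x 0] reach the same [gT]-orbit, cancelling gives a return
    after [j' - j <= r] steps, against the minimality of [r + 1]. *)
Lemma hermite_inj s x p l c :
  (forall i, equivariant (x i)) -> (forall i j y, x i (x j y) = x j (x i y)) ->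
  (forall i, injective (x i)) ->
  @hermite I s x p l c -> injective (fun a => (@eval _ s x p a).1).
Proof.
elim: s x l c => [|r s IH] x l c //=; first by move=> _ _ _ _ [] [].
move=> xE xC xI /and3P[Hh _ /forallP Hmin].
have xE' k : equivariant (shift x k) by apply: xE.
have xC' k k' z : shift x k (shift x k' z) = shift x k' (shift x k z) by apply: xC.
have xI' k : injective (shift x k) by apply: xI.
have {}IH := IH (shift x) l.1 (shift c) xE' xC' xI' Hh.
have itI j : injective (iter j (x 0%N)) by elim: j => //= j IHj u v /xI/IHj.
suff W (a a' : box s) (j j' : 'I_r.+1) : j <= j' ->
    (iter j (x 0%N) (eval (shift x) p a)).1 = (iter j' (x 0%N) (eval (shift x) p a')).1 ->
    (a, j) = (a', j').
  move=> [a j] [a' j'] /= e; case: (leqP j j') => jj; first exact: W e.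
  by symmetry; apply: W; [exact: ltnW|symmetry].
move=> jj /eq_fst_rmul; set h := (X in rmul _ X); rewrite -iter_equiv //.
rewrite -{1}(subnKC jj) iterD => /itI.
case: (posnP (j' - j)) => [/eqP|jj' e].
  rewrite subn_eq0 => jj2; have -> : j = j' by apply: val_inj; apply/eqP; rewrite eqn_leq jj.
  by rewrite subnn /= => /(congr1 fst)/= /IH ->.
have tr : (j' - j) < r.+1 by apply: leq_ltn_trans (leq_subr _ _) (ltn_ord _).
have := Hmin (Ordinal tr); rewrite /= jj' /= => /negP[].
set q := iter _ _ p.
(* This set is stable under the later generators by [hermite_morph], and the word [a'] takes [q]
   into it; undoing that word puts [q] there. *)
have : q \in [set emb (eval (s := s) (shift x) p) y | y in [set: box s * gT]].
  apply: (@eval_stable_inv _ s (shift x) _ _ a') => //.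
  - move=> i _ si /imsetP[y _ ->]; rewrite -(@hermite_morph s (shift x) p l.1 (shift c)) //.
    exact: imset_f.
  apply/imsetP; exists (a, h^-1) => //.
  rewrite /emb /= e iter_equiv // rmulA mulgV rmul1.
  symmetry; apply: eval_morph => i y _; symmetry.
  by apply: iter_morph => w; apply: xC.
by case/imsetP => y _ ->; apply: (codom_f (fun a => (eval (shift x) p a).1)).
Qed.

(** The base point of the model has the data [s], [l], [c]; a morphism injective on orbits preserves
    both the return relation and its minimality. *)
Lemma morph_hermite s x (f : box s * gT -> I * gT) l c :
  equivariant f -> injective (fun a => (f (a, 1)).1) ->
  (forall i y, i < size s -> f (@model s l c i y) = x i (f y)) ->
  @hermite I s x (f (box0 s, 1)) l c.
Proof.
elim: s x f l c => [|r s IH] x f l c //= fE fI fM.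
pose f' (y : box s * gT) := f ((y.1, @ord0 r), y.2).
have fM' i y : i < size s -> f' (model l.1 (shift c) i y) = shift x i (f' y).
  by move=> si; rewrite /shift -fM //= /f' -surjective_pairing.
have fE' : equivariant f' by move=> y h; rewrite /f' -fE.
have ev a : eval (s := s) (shift x) (f' (box0 s, 1)) a = f' (a, 1).
  by rewrite -(eval_morph (f := f') (x := model l.1 (shift c))) // eval_model.
apply/and3P; split.
- apply: (IH (shift x) f') => // a b /fI; by case.
- rewrite ev -(iter_morph (f := f) (g := @model (r :: s) l c 0)) => [|y]; last exact: (fM 0%N).
  rewrite iter_model // -(fM 0%N) //= inordK // ltnn eval_model /= mulg1.
  by rewrite -fE' /f' /= mul1g.
apply/forallP => j; apply/implyP => j0; apply/codomP => -[a].
rewrite ev -(iter_morph (f := f) (g := @model (r :: s) l c 0)) => [|y]; last exact: (fM 0%N).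
rewrite iter_model; last by rewrite -ltnS.
move=> /fI[_ /(congr1 val)] /=.
by rewrite inordK // => j1; rewrite j1 in j0.
Qed.

(* With [x_i^(r_i) p = V_i p c_i], where [V_i] is the word encoded by [l], the
   elements [c_i c_j] and [c_j c_i] move [V_i (V_j p)] to the same point. *)
Lemma hermite_commute s x p l c i j :
  (forall i, equivariant (x i)) -> (forall i j y, x i (x j y) = x j (x i y)) ->
  @hermite I s x p l c -> i < size s -> j < size s -> commute (c i) (c j).
Proof.
move=> xE xC Hh si sj.
(* [dc x U] says that [U] commutes with every map commuting with the generators. Words have this
   property, and two such maps commute because the generators do. *)
pose dc (x : nat -> I * gT -> I * gT) U := forall f : I * gT -> I * gT,
  (forall i y, f (x i y) = x i (f y)) -> forall y, f (U y) = U (f y).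
have ex k : k < size s -> exists U V, [/\ dc x U, dc x V & U p = rmul (V p) (c k)].
  move: Hh {xE xC si sj}; elim: s x l c k => [|r s IH] x l c k //=.
  case/and3P=> Hh /eqP Hr _; case: k => [|k] sk; last first.
    have [U [V [dU dV e]]] := IH (shift x) l.1 (shift c) k Hh sk.
    exists U, V; split=> // f fx; [apply: dU|apply: dV] => i' y; exact: fx.
  exists (iter r.+1 (x 0%N)), (fun p => eval (s := s) (shift x) p l.2); split=> //.
    by move=> f fx y; apply: iter_morph => z; rewrite fx.
  by move=> f fx y; apply: eval_morph => i' z _; rewrite /shift fx.
have [U [V [dU dV e]]] := ex i si; have [U' [V' [dU' dV' e']]] := ex j sj.
have eqv W : dc x W -> equivariant W.
  by move=> dW y h; rewrite (dW (fun y => rmul y h)) // => k z; rewrite xE.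
have cc W W' : dc x W -> dc x W' -> forall y, W (W' y) = W' (W y).
  by move=> dW dW' y; apply: dW' => k z; symmetry; apply: dW => k' z'; apply: xC.
apply: (@rmul_inj _ (V (V' p))); rewrite -!rmulA.
rewrite (cc V V') // -(eqv V') // -e (cc V' U) // -(eqv U) // -e'.
by rewrite (cc U U') // e (eqv U') // (cc U' V) // e' (eqv V) // (cc V V').
Qed.

End Hermite.
End FreeSets.

(** * Existence and uniqueness of the Hermite data of a point *)

Lemma big_tuple_cons (R : Type) (idx : R) (op : Monoid.com_law idx) (T : finType)
    m (F : m.+1.-tuple T -> R) :
  \big[op/idx]_(t : m.+1.-tuple T) F t =
  \big[op/idx]_(h : T) \big[op/idx]_(t : m.-tuple T) F [tuple of h :: t].
Proof.
rewrite pair_bigA (reindex (fun u : T * m.-tuple T => [tuple of u.1 :: u.2])) //=.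
exists (fun t => (thead t, [tuple of behead t])) => [[h t]|t] _ /=.
  by congr (_, _); apply: val_inj.
by rewrite -tuple_eta.
Qed.

Lemma sum_nat_unique (T : finType) (P : pred T) u0 :
  P u0 -> (forall u, P u -> u = u0) -> \sum_u (P u : nat) = 1.
Proof.
move=> P0 PU; rewrite (bigD1 u0) //= P0 big1 // => u /eqP nu.
by case E: (P u) => //; case: nu; apply: PU.
Qed.

Section Counting.
Variable gT : finGroupType.

(** The later generators have unique data by induction. The first return under [x 0] to their orbit
    fixes the new diagonal entry; the return point fixes the off-diagonal part by [hermite_inj] and
    the holonomy by freeness. *)
Lemma hermite_unique (I : finType) m (x : nat -> I * gT -> I * gT) p :
  (forall i, equivariant (x i)) -> (forall i j y, x i (x j y) = x j (x i y)) ->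
  (forall i, injective (x i)) ->
  \sum_(t : m.-tuple 'I_#|I|) \sum_(l : lab (map val t)) \sum_(c : m.-tuple gT)
    (hermite x p l (nth 1%g c) : nat) = 1.
Proof.
elim: m x => [|m IH] x xE xC xI.
  rewrite (big_pred1 [tuple]) => [|t]; last by apply/esym/eqP/tuple0.
  rewrite (big_pred1 (tt : lab (map val [tuple of [::]]))) => [|[]] //=.
  by rewrite (big_pred1 [tuple]) => [|t]; last apply/esym/eqP/tuple0.
pose AB s (r : nat) (b : box s) (c0 : gT) :=
    (iter r.+1 (x 0) p == rmul (eval (shift x) p b) c0) &&
     [forall j : 'I_r.+1, (0 < j) ==>
       ((iter j (x 0) p).1 \notin codom (fun a => (@eval _ s (shift x) p a).1))].
transitivity (\sum_(r < #|I|) \sum_(t : m.-tuple 'I_#|I|) \sum_(l : lab (map val t))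
   \sum_(b : box (map val t)) \sum_(c0 : gT) \sum_(c : m.-tuple gT)
   (hermite (shift x) p l (nth 1%g c) : nat) * AB (map val t) r b c0).
  rewrite big_tuple_cons; apply: eq_bigr => r _; apply: eq_bigr => t _.
  rewrite [RHS]pair_bigA /=; apply: eq_bigr => l _.
  rewrite big_tuple_cons; apply: eq_bigr => c0 _; apply: eq_bigr => c _.
  by rewrite mulnb.
have xE' k : equivariant (shift x k) by apply: xE.
have xC' k k' z : shift x k (shift x k' z) = shift x k' (shift x k z) by apply: xC.
have xI' k : injective (shift x k) by apply: xI.
rewrite -[RHS](IH (shift x)) // exchange_big; apply: eq_bigr => t _.
rewrite exchange_big; apply: eq_bigr => l _.
transitivity (\sum_(c : m.-tuple gT) (hermite (shift x) p l (nth 1%g c) : nat) *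
   (\sum_(u : 'I_#|I| * box (map val t) * gT) AB (map val t) u.1.1 u.1.2 u.2)).
  under [RHS]eq_bigr do rewrite big_distrr.
  by rewrite [RHS]exchange_big [LHS]pair_bigA /= [LHS]pair_bigA.
apply: eq_bigr => c _; case E: hermite => //; rewrite mul1n.
set s := map val t in l E *.
pose Ev (a : box s) := (eval (shift x) p a).1.
have EI : injective Ev := hermite_inj xE' xC' xI' E.
(* Pigeonhole: two of the [#|I| + 1] iterates of [p] lie in one [gT]-orbit, and the difference of
   their exponents is a return time. *)
have ex : exists k, [&& 0 < k, k <= #|I| & (iter k (x 0) p).1 \in codom Ev].
  have : ~~ injectiveb (fun j : 'I_#|I|.+1 => (iter j (x 0) p).1).
    by apply/injectiveP => /leq_card; rewrite card_ord ltnn.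
  case/injectivePn => j [j' jj].
  wlog lt : j j' jj / j < j'.
    move=> W e; case: (ltngtP j j') jj => [lt|lt|/val_inj ->]; last by rewrite eqxx.
      by move=> jj; apply: (W j j').
    by rewrite eq_sym => jj; apply: (W j' j).
  move=> /esym/eq_fst_rmul; set h := (X in rmul _ X); rewrite -iter_equiv //.
  have itI k : injective (iter k (x 0)) by elim: k => //= k IHk u v /xI/IHk.
  rewrite -(subnKC (ltnW lt)) iterD => /itI e.
  exists (j' - j); rewrite subn_gt0 lt /= e (leq_trans (leq_subr _ _)); last by rewrite -ltnS.
  by apply/codomP; exists (box0 s); rewrite /Ev eval_box0.
case: (ex_minnP ex) => k /and3P[k0 kn /codomP[b eb]] kmin.
have kr : k.-1 < #|I| by rewrite prednK.
apply: (@sum_nat_unique _ (fun u : 'I_#|I| * box s * gT => AB s u.1.1 u.1.2 u.2)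
  ((Ordinal kr, b), ((eval (shift x) p b).2^-1 * (iter k (x 0) p).2)%g)).
  rewrite /AB /= -iterS prednK // -eq_fst_rmul // eqxx /=.
  apply/forallP => j; apply/implyP => j0; apply/negP => Hj.
  have jk : j < k := ltn_ord j.
  have := kmin j; rewrite j0 Hj (leq_trans (ltnW jk)) //= => /(_ isT).
  by rewrite leqNgt jk.
move=> [[r b'] c0] /andP[/eqP e0 /forallP Hr].
have e : iter r.+1 (x 0) p = rmul (eval (shift x) p b') c0 := e0.
have rk : r.+1 = k.
  apply/eqP; rewrite eqn_leq kmin ?andbT; last first.
    by rewrite ltn_ord e; apply/codomP; exists b'.
  rewrite leqNgt; apply/negP => kr'.
  by have := Hr (Ordinal kr'); rewrite /= k0 eb /= => /negP[]; apply: codom_f.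
have bb : b' = b.
  by apply: EI; rewrite -[RHS]/(Ev b) -eb -rk e.
subst b'; congr ((_, _), _); first by apply: val_inj; rewrite /= -rk.
apply: (@rmul_inj _ _ (eval (shift x) p b)).
by rewrite -eq_fst_rmul // -e -rk.
Qed.

End Counting.

(** * Commuting tuples in the wreath product *)

Definition ctup (T : finGroupType) (A : {set T}) m : {set m.-tuple T} :=
  [set x : m.-tuple T | all (mem A) x &&
     all (fun s => all (fun t => s * t == t * s)%g x) x].

Lemma ctup_tnthP (T : finGroupType) (A : {set T}) m (x : m.-tuple T) :
  reflect ((forall i, tnth x i \in A) /\
           (forall i j, commute (tnth x i) (tnth x j))) (x \in ctup A m).
Proof.
rewrite inE; apply: (iffP andP) => [[/all_tnthP xA /all_tnthP xC]|[xA xC]].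
  by split=> // i j; have /all_tnthP/(_ j)/eqP := xC i.
split; apply/all_tnthP => i; first exact: xA.
by apply/all_tnthP => j; apply/eqP/xC.
Qed.

(** Past its end a tuple is continued by 1, which commutes with everything, so it serves as a
    commuting family indexed by [nat]. *)
Lemma ctup_nth (T : finGroupType) (A : {set T}) m (x : m.-tuple T) :
  1%g \in A -> x \in ctup A m ->
  (forall i, nth 1%g x i \in A) /\
  (forall i j, commute (nth 1%g x i) (nth 1%g x j)).
Proof.
move=> A1 /ctup_tnthP[xA xC].
have nthE i : nth 1%g x i = 1%g \/ exists j, nth 1%g x i = tnth x j.
  case: (ltnP i m) => im; last by left; rewrite nth_default ?size_tuple.
  by right; exists (Ordinal im); rewrite (tnth_nth 1%g).
split=> [i|i j]; first by have [->|[i' ->]] := nthE i.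
have [->|[i' ->]] := nthE i; first exact/commute_sym/commute1.
by have [->|[j' ->]] := nthE j; [exact: commute1|exact: xC].
Qed.

Section Wreath.
Variable gT : finGroupType.

(* The wreath product, realised as the automorphisms of the free right
   [gT]-set [I * gT]. *)
Definition wset (I : finType) : {set {perm I * gT}} :=
  [set s : {perm I * gT} | [forall y : I * gT, forall h, s (rmul y h) == rmul (s y) h]].

Lemma wsetP (I : finType) (s : {perm I * gT}) : reflect (equivariant s) (s \in wset I).
Proof.
rewrite inE; apply: (iffP forallP) => [H y h|H y]; first by have /forallP/(_ h)/eqP := H y.
by apply/forallP => h; rewrite H.
Qed.

Lemma wset1 (I : finType) : 1%g \in wset I.
Proof. by apply/wsetP => y h; rewrite !perm1. Qed.

Section Extension.
Variables (B I : finType) (M : nat -> B * gT -> B * gT) (f : B -> I * gT).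
Hypothesis ME : forall i, equivariant (M i).
Hypothesis MC : forall i j y, M i (M j y) = M j (M i y).
Hypothesis MI : forall i, injective (M i).
Hypothesis fI : injective (fun b => (f b).1).

Let D : {set I} := ~: [set (f b).1 | b in [set: B]].
Let C := 'I_#|D|.

(** [psi] splits [I * gT] into the image of [emb f] and the free set on the remaining orbits [D],
    numbered by [C]. *)
Let psi (u : B * gT + C * gT) : I * gT :=
  match u with inl y => emb f y | inr y => (enum_val y.1, y.2) end.

Let psi_lr y z : psi (inl y) <> psi (inr z).
Proof.
move=> /(congr1 fst) /= e; have := enum_valP z.1.
by rewrite -e inE => /negP[]; apply/imset_f.
Qed.

Let psi_inj : injective psi.
Proof.
move=> [[b g]|[c g]] [[b' g']|[c' g']].
- move=> e; have /fI bb : (f b).1 = (f b').1 by move: e => /(congr1 fst).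
  by move: e; rewrite bb => /rmul_inj /= ->.
- by move=> /psi_lr.
- by move/esym=> /psi_lr.
by move=> [] /enum_val_inj -> ->.
Qed.

Let cardD : #|D| = #|I| - #|B|.
Proof. by rewrite cardsCs setCK card_imset // cardsT. Qed.

Let psi_surj y : y \in codom psi.
Proof.
apply: inj_card_onto => //.
rewrite card_sum !card_prod card_ord cardD -mulnDl subnKC //.
exact: leq_card fI.
Qed.

Let psi' y := iinv (psi_surj y).

Let psiK : cancel psi psi'.
Proof. by move=> u; apply: psi_inj; rewrite f_iinv. Qed.

Let psi'K : cancel psi' psi.
Proof. by move=> u; rewrite f_iinv. Qed.

Let psi_rmul u h : rmul (psi u) h =
  psi (match u with inl y => inl (rmul y h) | inr y => inr (rmul y h) end).
Proof. by case: u => y //=; rewrite emb_equiv. Qed.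

Let ext i (z : {perm C * gT}) (y : I * gT) : I * gT :=
  psi (match psi' y with inl b => inl (M i b) | inr c => inr (z c) end).

Let ext_inj i z : injective (ext i z).
Proof.
move=> y y' /psi_inj e; apply: (can_inj psi'K).
case: (psi' y) (psi' y') e => [b|c] [b'|c'] // [].
  by move=> /MI ->.
by move=> /perm_inj ->.
Qed.

Let extp i z : {perm I * gT} := perm (@ext_inj i z).

Let extpE i z u : extp i z (psi u) =
  psi (match u with inl b => inl (M i b) | inr c => inr (z c) end).
Proof. by rewrite permE /ext psiK. Qed.

Let extp_surj i (s : {perm I * gT}) :
  (forall y, s (emb f y) = emb f (M i y)) -> exists z, s = extp i z.
Proof.
move=> sM.
(* Since [M i] is bijective, [s] maps the image of [emb f] onto itself and hence keeps its
   complement. *)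
have sr y : exists c, s (psi (inr y)) = psi (inr c).
  case E : (psi' (s (psi (inr y)))) => [b|c]; last by exists c; rewrite -E psi'K.
  have [M' _ M'K] := injF_bij (@MI i).
  have : s (psi (inr y)) = s (psi (inl (M' b))).
    by rewrite /= sM M'K -[LHS]psi'K E.
  by move=> /perm_inj/esym/psi_lr.
have [z zE] := fin_all_exists sr.
have zI : injective z.
  by move=> y y' e; have := zE y; rewrite e -zE => /perm_inj/psi_inj[].
exists (perm zI); apply/permP => y; rewrite -(psi'K y) extpE.
case: (psi' y) => [b|c]; first exact: sM.
by rewrite permE zE.
Qed.

(* [f] embeds the system [M], so its commuting extensions to [I] are determined
   by what they do on the complement of the image. *)
Lemma card_extensions m :
  #|[set x in ctup (wset I) m |
      [forall i : 'I_m, forall y, tnth x i (emb f y) == emb f (M i y)]]|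
  = #|ctup (wset 'I_(#|I| - #|B|)) m|.
Proof.
rewrite -cardD -/C.
pose F (z : m.-tuple {perm C * gT}) := [tuple extp i (tnth z i) | i < m].
have extp_inj i z z' : extp i z = extp i z' -> z = z'.
  move=> e; apply/permP => y; have := extpE i z (inr y).
  by rewrite e extpE => /psi_inj[].
have FI : injective F.
  move=> z z' e; apply: eq_from_tnth => i.
  by apply: (extp_inj i); move: e => /(congr1 (fun t => tnth t i)); rewrite !tnth_mktuple.
rewrite -(card_imset _ FI); apply: eq_card => x.
have wext i z : (extp i z \in wset I) = (z \in wset C).
  apply/wsetP/wsetP => H.
    move=> y h; have := H (psi (inr y)) h.
    by rewrite psi_rmul !extpE psi_rmul => /psi_inj[].
  move=> y h; rewrite -(psi'K y) psi_rmul !extpE psi_rmul.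
  by case: (psi' y) => [b|c]; rewrite ?ME ?H.
have cext i j z z' : commute (extp i z) (extp j z') <-> commute z z'.
  split=> H.
    apply/permP => y; have := congr1 (fun s : {perm _} => s (psi (inr y))) H.
    by rewrite !permM !extpE => /psi_inj[].
  apply/permP => y; rewrite -(psi'K y) !permM !extpE.
  case: (psi' y) => [b|c]; first by rewrite MC.
  by rewrite -!permM H.
have ctE z : (F z \in ctup (wset I) m) = (z \in ctup (wset C) m).
  by apply/ctup_tnthP/ctup_tnthP => -[zA zC];
     (split=> [i|i j]; [have := zA i|have := zC i j]); rewrite !tnth_mktuple ?wext ?cext.
apply/idP/imsetP => [|[z zC ->]].
  rewrite inE => /andP[xC /forallP xM].
  have [z zE] := fin_all_exists
    (fun i : 'I_m => @extp_surj i (tnth x i) (fun y => eqP (forallP (xM i) y))).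
  have xE : x = F [tuple z i | i < m].
    by apply: eq_from_tnth => i; rewrite !tnth_mktuple zE.
  by exists [tuple z i | i < m] => //; rewrite -ctE -xE.
rewrite inE ctE zC /=; apply/forallP => i; apply/forallP => y.
by rewrite tnth_mktuple; apply/eqP; apply: (extpE i _ (inl y)).
Qed.

End Extension.

Lemma card_inj_fst (B I : finType) :
  #|[set f : {ffun B -> I * gT} | injectiveb (fun b => (f b).1)]|
  = (#|I| ^_ #|B| * #|gT| ^ #|B|).
Proof.
rewrite -card_inj_ffuns -card_ffun -[#|{ffun B -> gT}|]cardsT -cardsX.
pose F (u : {ffun B -> I} * {ffun B -> gT}) := [ffun b => (u.1 b, u.2 b)].
have FI : injective F.
  move=> [u v] [u' v'] /ffunP e; congr (_, _); apply/ffunP => b;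
  by have := e b; rewrite !ffunE => -[].
rewrite -(card_imset _ FI); apply: eq_card => f; rewrite inE.
apply/injectiveP/imsetP => [fI|[u]].
  exists ([ffun b => (f b).1], [ffun b => (f b).2]).
    rewrite !inE andbT; apply/injectiveP => b b'; rewrite !ffunE; exact: fI.
  by apply/ffunP => b; rewrite !ffunE; case: (f b).
rewrite !inE andbT => /injectiveP uI -> b b'; rewrite !ffunE; exact: uI.
Qed.

Section Fixed.
Variables (I : finType) (m : nat).

Definition pfun (x : m.-tuple {perm I * gT}) (i : nat) : I * gT -> I * gT := nth 1%g x i.

Lemma pfunP x : x \in ctup (wset I) m ->
  [/\ forall i, equivariant (pfun x i),
      forall i j y, pfun x i (pfun x j y) = pfun x j (pfun x i y)
    & forall i, injective (pfun x i)].
Proof.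
case/(ctup_nth (wset1 I)) => xA xC.
split=> [i|i j y|i]; first exact: (elimT (wsetP _) (xA i)).
  by have /permP/(_ y) := xC j i; rewrite !permM.
exact: perm_inj.
Qed.

(** Points with these data correspond to embeddings of the model: [p] gives its orbit map, and an
    embedding gives back its value at the origin. *)
Lemma card_hermite_points (s : seq nat) (l : lab s) c x :
  size s = m -> x \in ctup (wset I) m ->
  \sum_p (hermite (pfun x) p l c : nat) =
  \sum_(f : {ffun box s -> I * gT} | injectiveb (fun b => (f b).1))
    [forall i : 'I_m, forall y, tnth x i (emb f y) == emb f (model l c i y)].
Proof.
move=> sm xC; have [xE xCC xI] := pfunP xC.
rewrite [LHS](_ : _ = #|[set p | hermite (pfun x) p l c]|); last first.
  by rewrite -sum1dep_card [RHS]big_mkcond.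
rewrite -big_mkcondr sum1dep_card.
pose F p := [ffun a => eval (s := s) (pfun x) p a].
have FI : injective F.
  by move=> p q /ffunP/(_ (box0 s)); rewrite !ffunE !eval_box0.
have embF p y : emb (F p) y = emb (eval (s := s) (pfun x) p) y.
  by rewrite /emb ffunE.
rewrite -(card_imset _ FI); apply: eq_card => f; rewrite inE.
apply/imsetP/andP => [[p]|[/injectiveP fI /forallP fM]].
  rewrite inE => hp ->; split.
    by apply/injectiveP => a b; rewrite !ffunE; apply: hermite_inj hp _ _.
  apply/forallP => i; apply/forallP => y; rewrite !embF (hermite_morph _ _ _ hp) //.
    by rewrite /pfun -tnth_nth.
  by rewrite sm.
have fM' i y : i < size s -> emb f (model l c i y) = pfun x i (emb f y).
  rewrite sm => im; have /forallP/(_ y)/eqP := fM (Ordinal im).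
  by rewrite (tnth_nth 1%g).
exists (f (box0 s)).
  rewrite inE -[f _]rmul1 -[rmul _ _]/(emb f (box0 s, 1%g)).
  apply: morph_hermite => //; first exact: emb_equiv.
apply/ffunP => a; rewrite ffunE.
rewrite -[f (box0 s)]rmul1 -[rmul _ _]/(emb f (box0 s, 1%g)).
by rewrite -(eval_morph (f := emb f) (x := model l c)) // eval_model /emb rmul1.
Qed.

(** For commuting [c], summing over embeddings first leaves the extensions of each, counted by
    [card_extensions]; otherwise [hermite_commute] excludes every point. *)
Lemma card_hermite (s : seq nat) (l : lab s) (c : m.-tuple gT) : size s = m ->
  \sum_(x in ctup (wset I) m) \sum_p (hermite (pfun x) p l (nth 1%g c) : nat) =
  (c \in ctup [set: gT] m) *
  (#|I| ^_ #|box s| * #|gT| ^ #|box s| * #|ctup (wset 'I_(#|I| - #|box s|)) m|).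
Proof.
move=> sm.
have [/(ctup_nth (in_setT _))[_ cC]|cN] := boolP (c \in _).
  rewrite mul1n; under eq_bigr => x xC do rewrite card_hermite_points //.
  rewrite exchange_big /= -card_inj_fst -sum_nat_const.
  rewrite [RHS](eq_bigl
    (fun f : {ffun box s -> I * gT} => injectiveb (fun b => (f b).1))); last first.
    by move=> f; rewrite inE.
  apply: eq_bigr => f /injectiveP fI.
  rewrite -(@card_extensions _ I (model l (nth 1%g c)) f) //.
  - by rewrite -sum1dep_card big_mkcondr.
  - by move=> i; apply: model_equivariant.
  - by move=> i j y; apply: model_comm.
  - by move=> i; apply: model_inj.
rewrite mul0n big1 // => x xC; rewrite big1 // => p _.
have [xE xCC xI] := pfunP xC.
case E: hermite => //; case/negP: cN; apply/ctup_tnthP.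
split=> [i|i j]; first by rewrite inE.
by rewrite !(tnth_nth 1%g); apply: (hermite_commute xE xCC E); rewrite sm.
Qed.

(* Double counting of the pairs (commuting tuple, point), sorted by the Hermite
   data of the point. *)
Lemma card_ctup_rec :
  #|ctup (wset I) m| * (#|I| * #|gT|) =
  \sum_(t : m.-tuple 'I_#|I|) #|lab (map val t)| * #|ctup [set: gT] m| *
  (#|I| ^_ #|box (map val t)| * #|gT| ^ #|box (map val t)| *
     #|ctup (wset 'I_(#|I| - #|box (map val t)|)) m|).
Proof.
rewrite -card_prod -sum_nat_const.
transitivity (\sum_(x in ctup (wset I) m) \sum_(p : I * gT)
  \sum_(t : m.-tuple 'I_#|I|) \sum_(l : lab (map val t)) \sum_(c : m.-tuple gT)
    (hermite (pfun x) p l (nth 1%g c) : nat)).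
  apply: eq_bigr => x xC; have [xE xCC xI] := pfunP xC.
  by rewrite -sum1_card; apply: eq_bigr => p _; rewrite hermite_unique.
under eq_bigr do rewrite exchange_big.
rewrite exchange_big; apply: eq_bigr => t _ /=.
under eq_bigr do rewrite exchange_big.
rewrite exchange_big /= -mulnA -sum_nat_const; apply: eq_bigr => l _.
under eq_bigr do rewrite exchange_big.
rewrite exchange_big /= -sum_nat_const [RHS]big_mkcond; apply: eq_bigr => c _.
rewrite card_hermite ?size_map ?size_tuple //.
by case: ifP => _; rewrite ?mul1n ?mul0n.
Qed.

End Fixed.
End Wreath.

(** * Counting Hermite normal forms by index *)

Lemma card_box_gt0 s : 0 < #|box s|.
Proof. by apply/card_gt0P; exists (box0 s). Qed.

Lemma card_box_cons r s : #|box (r :: s)| = #|box s| * r.+1.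
Proof. by rewrite /= card_prod card_ord. Qed.

Lemma card_lab_cons r s : #|lab (r :: s)| = #|lab s| * #|box s|.
Proof. by rewrite /= card_prod. Qed.

Lemma card_box s : #|box s| = \prod_(i < size s) (nth 0 s i).+1.
Proof.
elim: s => [|r s IH] /=; first by rewrite big_ord0 card_unit.
by rewrite card_prod card_ord IH big_ord_recl mulnC.
Qed.

(** The entry at position [i] is a factor of [#|box|] for exactly the [i] proper tails that still
    contain it. *)
Lemma card_lab s : #|lab s| = \prod_(i < size s) (nth 0 s i).+1 ^ i.
Proof.
elim: s => [|r s IH] /=; first by rewrite big_ord0 card_unit.
rewrite card_prod IH card_box big_ord_recl expn0 mul1n -big_split /=.
by apply: eq_bigr => i _; rewrite expnSr.
Qed.

(* The number of subgroups of index [d] in the free abelian group of rank [m]. *)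
Fixpoint nsub (m d : nat) : nat :=
  if m is m'.+1 then \sum_(e < d.+1 | e %| d) e * nsub m' e else (d == 1).

Lemma nsub0 m : nsub m 0 = 0.
Proof. by case: m => //= m; rewrite big_mkcond big_ord_recl big_ord0. Qed.

(** Grouping the tuples by [e = #|box|] gives the recursion of [nsub]. The count for rank [m] is a
    hypothesis so that the lemma can be used inside the induction proving that count. *)
Lemma sum_lab_dvd_aux m M d : 0 < d -> d <= M ->
  (forall e, 0 < e -> e <= M -> \sum_(t : m.-tuple 'I_M | #|box (map val t)| == e)
    #|lab (map val t)| = nsub m e) ->
  \sum_(t : m.-tuple 'I_M | #|box (map val t)| %| d)
    #|lab (map val t)| * #|box (map val t)| = nsub m.+1 d.
Proof.
move=> d0 dM H /=.
have lt (t : m.-tuple 'I_M) : #|box (map val t)| %| d -> #|box (map val t)| < d.+1.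
  by move=> td; rewrite ltnS dvdn_leq.
rewrite (partition_big (fun t : m.-tuple 'I_M => inord #|box (map val t)| : 'I_d.+1)
  (fun e : 'I_d.+1 => e %| d)) /=; last by move=> t td; rewrite inordK ?lt.
apply: eq_bigr => e ed.
rewrite -H; [|exact: dvdn_gt0 ed|by rewrite (leq_trans _ dM) // -ltnS].
rewrite big_distrr /=; apply: eq_big => [t|t /andP[td /eqP <-]]; last first.
  by rewrite inordK ?lt // mulnC.
apply/andP/eqP => [[td /eqP <-]|te]; first by rewrite inordK ?lt.
by rewrite te; split=> //; rewrite inord_val.
Qed.

(** Dropping the first entry leaves a tuple whose index [b] divides [d]; the dropped diagonal entry
    must be [d / b], and it brings [b] choices of off-diagonal part. *)
Lemma sum_lab m M d : 0 < d -> d <= M ->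
  \sum_(t : m.-tuple 'I_M | #|box (map val t)| == d) #|lab (map val t)| = nsub m d.
Proof.
elim: m d => [|m IH] d d0 dM.
  rewrite big_mkcond (big_pred1 [tuple]) => [|t]; last by apply/esym/eqP/tuple0.
  by rewrite /= !card_unit eq_sym; case: eqP.
rewrite -(sum_lab_dvd_aux d0 dM) // big_mkcond big_tuple_cons exchange_big.
rewrite [RHS]big_mkcond; apply: eq_bigr => t _.
set b := #|box (map val t)|; have b0 : 0 < b := card_box_gt0 _.
transitivity (\sum_(r < M | b * r.+1 == d) #|lab (map val t)| * b).
  rewrite [RHS]big_mkcond; apply: eq_bigr => r _.
  by rewrite -(card_box_cons r) -(card_lab_cons r).
rewrite sum_nat_const mulnC.
case: ifP => bd.
  have /divnK e := bd.
  have q0 : 0 < d %/ b by rewrite divn_gt0 // dvdn_leq.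
  have lt : (d %/ b).-1 < M.
    by rewrite prednK // (leq_trans (leq_div _ _)).
  rewrite (eq_card1 (x := Ordinal lt)) ?muln1 // => r.
  rewrite -[LHS]/(b * r.+1 == d) -[RHS]/(r == Ordinal lt).
  rewrite -(inj_eq val_inj) /= -[in LHS]e mulnC eqn_pmul2r //.
  by rewrite -[in LHS](prednK q0).
rewrite eq_card0 ?muln0 // => r; rewrite unfold_in /=.
by apply/eqP => e; rewrite -e dvdn_mulr in bd.
Qed.

Lemma sum_lab_dvd m M d : 0 < d -> d <= M ->
  \sum_(t : m.-tuple 'I_M | #|box (map val t)| %| d)
    #|lab (map val t)| * #|box (map val t)| = nsub m.+1 d.
Proof. by move=> d0 dM; apply: sum_lab_dvd_aux => // e e0 eM; apply: sum_lab. Qed.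

Lemma card_ctup_ord_rec (gT : finGroupType) m n :
  n * #|gT| * #|ctup (wset gT 'I_n) m| =
  \sum_(d < n.+1) nsub m d * #|ctup [set: gT] m| *
     (n ^_ d * #|gT| ^ d * #|ctup (wset gT 'I_(n - d)) m|).
Proof.
have := card_ctup_rec gT 'I_n m; rewrite !card_ord mulnC => ->.
(* Indices above [n] contribute nothing, since the falling factorial vanishes. *)
rewrite (bigID (fun t : m.-tuple 'I_n => #|box (map val t)| < n.+1)) /=.
rewrite [X in _ + X]big1 ?addn0; last first.
  by move=> t; rewrite -leqNgt => /ffact_small ->; rewrite !mul0n muln0.
rewrite (partition_big (fun t : m.-tuple 'I_n => inord #|box (map val t)| : 'I_n.+1) predT) //=.
apply: eq_bigr => d _; case: (posnP d) => [d0|d0].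
  rewrite d0 nsub0 !mul0n big1 // => t /andP[lt /eqP e].
  by have := card_box_gt0 (map val t); rewrite -[#|box _|](inordK lt) e d0.
have dn : d <= n by rewrite -ltnS.
rewrite -(@sum_lab m n) // !big_distrl /=.
apply: eq_big => [t|t /andP[lt /eqP <-]]; last by rewrite inordK.
apply/andP/eqP => [[lt /eqP <-]|te]; first by rewrite inordK.
by rewrite te ltn_ord inord_val eqxx.
Qed.

(** * The wreath product as equivariant permutations, and the recursion for its characteristics *)

Section Bridge.
Variable gT : finGroupType.
Import GRing.Theory Num.Theory.

(** [f] reverses products, which does not affect commutation; the reversal is there because
    permutations are composed from left to right. *)
Lemma card_commuting_ffun (T : finType) (W : finGroupType) (A : {set W})
    (op : T -> T -> T) (f : T -> W) m :
  injective f -> f @: [set: T] = A ->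
  (forall x y, f (op x y) = (f y * f x)%g) ->
  #|[set x : {ffun 'I_m -> T} | [forall i, forall j, op (x i) (x j) == op (x j) (x i)]]|
  = #|ctup A m|.
Proof.
move=> fI fA fM.
pose F (x : {ffun 'I_m -> T}) := [tuple f (x i) | i < m].
have FI : injective F.
  move=> x y e; apply/ffunP => i; apply: fI.
  by move: e => /(congr1 (fun t => tnth t i)); rewrite !tnth_mktuple.
rewrite -(card_imset _ FI); apply: eq_card => t.
apply/imsetP/ctup_tnthP => [[x] + ->|[tA tC]].
  rewrite inE => /forallP xC.
  split=> [i|i j]; rewrite !tnth_mktuple; first by rewrite -fA imset_f.
  by rewrite /commute -!fM; have /forallP/(_ i)/eqP -> := xC j.
have ex (i : 'I_m) : exists x, tnth t i = f x.
  by have := tA i; rewrite -fA => /imsetP[x _ ->]; exists x.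
have [x xE] := fin_all_exists ex.
exists (finfun x); last by apply: eq_from_tnth => i; rewrite tnth_mktuple ffunE.
rewrite inE; apply/forallP => i; apply/forallP => j; apply/eqP/fI.
by rewrite !ffunE !fM -!xE; apply: tC.
Qed.

Lemma chiG_ctup k : chiG gT k = ((#|ctup [set: gT] k.+1|)%:R / (#|gT|)%:R)%R.
Proof.
rewrite /chiG; congr (_%:R / _)%R.
have := @card_commuting_ffun gT gT [set: gT] (fun x y => y * x)%g id k.+1.
move=> <- //; last by rewrite imset_id.
apply: eq_card => x; rewrite !inE; apply: eq_forallb => i.
by apply: eq_forallb => j; rewrite eq_sym.
Qed.

Section ToPerm.
Variable n : nat.

(** The factor is read at the target orbit [w.2 y.1]; this matches the twist by the inverse
    permutation in [wmul] and gives a left action. *)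
Definition wact (w : wreath gT n) (y : 'I_n * gT) : 'I_n * gT :=
  (w.2 y.1, w.1 (w.2 y.1) * y.2)%g.

Lemma wact_inj w : injective (wact w).
Proof. by move=> [i g] [j h] [] /= /perm_inj -> /mulgI ->. Qed.

Definition wperm w : {perm 'I_n * gT} := perm (@wact_inj w).

Lemma wpermE w y : wperm w y = wact w y.
Proof. by rewrite permE. Qed.

Lemma wpermM x y : wperm (wmul x y) = (wperm y * wperm x)%g.
Proof.
by apply/permP => -[i g]; rewrite permM !wpermE /wact /= !permM ffunE permK mulgA.
Qed.

Lemma wperm_inj : injective wperm.
Proof.
move=> [g s] [g' s'] e.
have e' y := congr1 (fun p : {perm _} => p y) e.
have ss : s = s' by apply/permP => i; have := e' (i, 1%g); rewrite !wpermE => -[].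
subst s'; congr (_, _); apply/ffunP => i.
by have := e' (s^-1%g i, 1%g); rewrite !wpermE /wact /= permKV => -[/mulIg].
Qed.

(** An equivariant permutation is determined by the images of the points [(i, 1)]: their orbits give
    the permutation, their second components the factors. *)
Lemma wperm_wset : wperm @: [set: wreath gT n] = wset gT 'I_n.
Proof.
apply/setP => s; apply/imsetP/wsetP => [[w _ ->] y h|sE].
  by rewrite !wpermE /wact /rmul /= mulgA.
have sI : injective (fun i => (s (i, 1%g)).1).
  move=> i j /eq_fst_rmul; rewrite -sE => /perm_inj[]; by [].
exists ([ffun i => (s ((perm sI)^-1%g i, 1%g)).2], perm sI) => //.
apply/permP => -[i g]; rewrite wpermE /wact /= ffunE permK permE.
rewrite -[(i, g)]/(i, g)%g -{1}[g]mul1g -[(i, _)]/(rmul (i, 1%g) g) sE.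
by [].
Qed.

Lemma chiGn_ctup k : chiGn gT k n =
  ((#|ctup (wset gT 'I_n) k.+1|)%:R / (#|gT| ^ n * n`!)%:R)%R.
Proof.
rewrite /chiGn; congr (_%:R / _)%R.
apply: (card_commuting_ffun k.+1 (@wperm_inj) wperm_wset wpermM).
Qed.

End ToPerm.

Lemma chiGn0 k : chiGn gT k 0 = 1%R.
Proof.
rewrite chiGn_ctup expn0 fact0 mul1n divr1.
rewrite (eq_card1 (x := [tuple 1%g | i < k.+1])) // => x.
have p1 (s : {perm 'I_0 * gT}) : s = 1%g by apply/permP => -[[]].
have -> : x = [tuple 1%g | i < k.+1].
  by apply: eq_from_tnth => i; rewrite tnth_mktuple; apply: p1.
rewrite [RHS]inE eqxx; apply/ctup_tnthP.
by split=> [i|i j]; rewrite !tnth_mktuple ?wset1.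
Qed.

Lemma lhs_seriesE k n : lhs_series gT k n = chiGn gT k n.
Proof. by rewrite /lhs_series; case: eqP => // ->; rewrite chiGn0. Qed.

(** Divide the counting recursion by [|G| |G|^n n!] and use that [n ^_ d] times [(n - d)!] is
    [n!]. *)
Lemma lhs_series_rec k n :
  (n%:R * lhs_series gT k n =
   smul (fun d => chiG gT k * (nsub k.+1 d)%:R) (lhs_series gT k) n)%R.
Proof.
rewrite /smul; under eq_bigr do rewrite lhs_seriesE chiGn_ctup.
rewrite lhs_seriesE chiGn_ctup chiG_ctup.
have G0 : ((#|gT|)%:R != 0 :> rat)%R by rewrite pnatr_eq0 -lt0n; apply/card_gt0P; exists 1%g.
have f0 j : ((j`!)%:R != 0 :> rat)%R by rewrite pnatr_eq0 -lt0n fact_gt0.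
have := congr1 (fun a => a%:R : rat)%R (card_ctup_ord_rec gT k.+1 n).
rewrite !natrM natr_sum => H.
have GX j : ((#|gT| ^ j)%:R != 0 :> rat)%R by rewrite natrX expf_neq0.
transitivity ((n%:R * (#|gT|)%:R * (#|ctup (wset gT 'I_n) k.+1|)%:R) /
   ((#|gT|)%:R * ((#|gT| ^ n)%:R * (n`!)%:R)) : rat)%R.
  by field; rewrite G0 f0 GX.
rewrite H mulr_suml; apply: eq_bigr => d _.
have dn : d <= n by rewrite -ltnS.
rewrite !natrM -[in (#|gT| ^ n)%:R%R](subnKC dn) expnD.
rewrite -(ffact_fact dn) !natrM.
have F0 : ((n ^_ d)%:R != 0 :> rat)%R by rewrite pnatr_eq0 -lt0n ffact_gt0.
by field; rewrite G0 f0 F0 !GX.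
Qed.

End Bridge.

(** * Logarithmic derivatives of power series *)

Import Order.TTheory GRing.Theory Num.Theory.
Local Open Scope ring_scope.

(** Working modulo [t^N] makes the ring laws and the derivative of [{poly rat}] available for
    series. *)
Definition trunc (N : nat) (f : series) : {poly rat} := \poly_(i < N) f i.

Definition eqlow (N : nat) (p q : {poly rat}) := forall i, (i < N)%N -> p`_i = q`_i.

Lemma eqlow_mul N p p' q q' : eqlow N p p' -> eqlow N q q' -> eqlow N (p * q) (p' * q').
Proof.
move=> pp qq i iN; rewrite !coefM; apply: eq_bigr => j _.
have jN : (j < N)%N by apply: leq_ltn_trans iN; rewrite -ltnS.
by rewrite pp // qq // (leq_ltn_trans (leq_subr _ _)).
Qed.

Lemma trunc_mul N f g : eqlow N (trunc N (smul f g)) (trunc N f * trunc N g).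
Proof.
move=> i iN; rewrite coef_poly iN coefM; apply: eq_bigr => j _.
have jN : (j < N)%N by apply: leq_ltn_trans iN; rewrite -ltnS.
by rewrite !coef_poly jN (leq_ltn_trans (leq_subr _ _) iN).
Qed.

Lemma smulE N f g n : (n < N)%N -> smul f g n = (trunc N f * trunc N g)`_n.
Proof. by move=> nN; rewrite -trunc_mul // coef_poly nN. Qed.

Lemma smulC f g : smul f g = smul g f.
Proof.
by apply: functional_extensionality => n; rewrite !(@smulE n.+1) // mulrC.
Qed.

Lemma smulA f g h : smul f (smul g h) = smul (smul f g) h.
Proof.
apply: functional_extensionality => n; rewrite !(@smulE n.+1) //.
transitivity ((trunc n.+1 f * (trunc n.+1 g * trunc n.+1 h))`_n).
  by apply: (@eqlow_mul n.+1) => //; apply: trunc_mul.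
by rewrite mulrA; symmetry; apply: (@eqlow_mul n.+1) => //; apply: trunc_mul.
Qed.

Lemma smul0 f g : smul f g 0%N = f 0%N * g 0%N.
Proof. by rewrite /smul big_ord_recl big_ord0 addr0. Qed.

Lemma trunc_spow N f j : eqlow N (trunc N (spow f j)) (trunc N f ^+ j).
Proof.
elim: j => [|j IH] i iN; first by rewrite coef_poly iN expr0 coef1.
by rewrite /= trunc_mul // exprS; apply: (@eqlow_mul N).
Qed.

Lemma spowE N f j n : (n < N)%N -> spow f j n = (trunc N f ^+ j)`_n.
Proof. by move=> nN; rewrite -trunc_spow // coef_poly nN. Qed.

(* [l] is the logarithmic derivative [t f' / f] of [f]. *)
Definition logder (f l : series) := forall n, n%:R * f n = smul l f n.

Lemma logder1 : logder sone (fun=> 0).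
Proof.
move=> n; rewrite /smul big1 => [|i _]; last by rewrite mul0r.
by rewrite /sone; case: eqP => [->|]; rewrite ?mul0r ?mulr0.
Qed.

Lemma logder_mul f g l l' : logder f l -> logder g l' ->
  logder (smul f g) (fun n => l n + l' n).
Proof.
move=> lf lg n.
have thE (u v : series) : logder u v -> (fun n => n%:R * u n) = smul v u.
  by move=> uv; apply: functional_extensionality => k; apply: uv.
transitivity (smul (fun n => n%:R * f n) g n + smul f (fun n => n%:R * g n) n).
  rewrite /smul mulr_sumr -big_split /=; apply: eq_bigr => i _.
  have in' : (i <= n)%N by rewrite -ltnS.
  by rewrite -[in n%:R](subnKC in') natrD; ring.
rewrite (thE _ _ lf) (thE _ _ lg) [smul f (smul _ _)]smulA [smul f l']smulC.
rewrite -!smulA /smul -big_split /=; apply: eq_bigr => i _.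
by rewrite mulrDl.
Qed.

Lemma logder_spow f l j : logder f l -> logder (spow f j) (fun n => j%:R * l n).
Proof.
move=> lf; elim: j => [|j IH].
  by move=> n; rewrite -[RHS]/(smul _ sone n) logder1; congr smul;
     apply: functional_extensionality => k; rewrite mul0r.
move=> n; rewrite (logder_mul lf IH) -/(spow f j.+1); congr (smul _ _ n).
by apply: functional_extensionality => k; rewrite -[j.+1]add1n natrD mulrDl mul1r.
Qed.

Lemma logder_prod (T : finType) (f l : T -> series) :
  (forall r, logder (f r) (l r)) ->
  logder (\big[smul/sone]_r f r) (fun n => \sum_r l r n).
Proof.
move=> fl.
pose add (u v : series) : series := fun n => u n + v n.
have -> : (fun n => \sum_r l r n) = \big[add/(fun=> 0)]_r l r.
  apply: functional_extensionality => n.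
  by rewrite (big_morph (fun u : series => u n) (id1 := 0) (op1 := +%R)).
by apply: (big_ind2 logder) => [|f1 l1 f2 l2|r _]; [exact: logder1|exact: logder_mul|exact: fl].
Qed.

(** The identity behind this is [t (1 - t^m)' = - m t^m = - m (t^m + t^(2m) + ...) (1 - t^m)]. *)
Lemma logder_one_minus m : (0 < m)%N ->
  logder (one_minus_tpow m) (fun d => - (m%:R *+ ((0 < d) && (m %| d))%N)).
Proof.
move=> m0 n; rewrite /smul big_ord_recr /= subnn /one_minus_tpow eqxx.
rewrite (eq_sym 0%N) (gtn_eqF m0) subr0 mulr1.
case: (posnP n) => [->|n0]; first by rewrite big_ord0 mul0r add0r oppr0.
rewrite /= sub0r.
have ni0 (i : 'I_n) : (n - i == 0)%N = false.
  by apply/eqP; have := ltn_ord i; lia.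
(* With [i = n] split off, the factor [1 - t^m] leaves only [i = n - m], which counts when it is
   positive. *)
have -> : \sum_(i < n) - (m%:R *+ ((0 < i) && (m %| i))%N) *
    ((n - i == 0)%N%:R - (n - i == m)%N%:R) =
    (if ((m < n) && (m %| n))%N then m%:R else 0) :> rat.
  case: (ltnP m n) => mn /=; last first.
    apply: big1 => i _; rewrite ni0 /= sub0r mulrNN.
    case: (posnP i) => [->|i0]; first by rewrite mul0r.
    by rewrite (_ : (n - i == m)%N = false) ?mulr0 //; apply/eqP; lia.
  have nm : (n - m < n)%N by lia.
  rewrite (bigD1 (Ordinal nm)) //= big1 => [|i /eqP ni]; last first.
    rewrite ni0 /= sub0r mulrNN.
    rewrite (_ : (n - i == m)%N = false) ?mulr0 //.
    by apply/eqP => e; apply: ni; apply: val_inj => /=; have := ltn_ord i; lia.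
  rewrite subKn ?(ltnW mn) // eqxx (gtn_eqF m0) sub0r mulrNN mulr1 addr0.
  by rewrite subn_gt0 mn dvdn_subl ?dvdnn ?(ltnW mn) //; case: (m %| n)%N.
case: (ltngtP m n) => [mn|mn|<-] /=.
- by rewrite oppr0 mulr0; case: (m %| n)%N; rewrite ?addrN ?oppr0 ?addr0.
- by rewrite gtnNdvd // !mulr0n oppr0 mulr0 addr0.
- by rewrite dvdnn !mulr1n mulrN mulr1 add0r.
Qed.

(** As [l 0 = 0], the right side involves only earlier coefficients of [f], and division by [n]
    recovers [f n]. The bound [N] allows for truncated products, whose recursion holds only in low
    degrees. *)
Lemma logder_unique N f g l l' : f 0%N = g 0%N ->
  (forall n, (n <= N)%N -> n%:R * f n = smul l f n) ->
  (forall n, (n <= N)%N -> n%:R * g n = smul l' g n) ->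
  l 0%N = 0 -> (forall n, (n <= N)%N -> l n = l' n) ->
  forall n, (n <= N)%N -> f n = g n.
Proof.
move=> fg0 Hf Hg l0 ll n; elim/ltn_ind: n => -[|n] // IH nN.
have n0 : n.+1%:R != 0 :> rat by rewrite pnatr_eq0.
apply: (mulfI n0); rewrite Hf // Hg // /smul.
apply: eq_bigr => i _; rewrite -ll; last by rewrite (leq_trans _ nN) // -ltnS.
case: (posnP i) => [->|i0]; first by rewrite l0 !mul0r.
by rewrite IH //; [rewrite ltn_subrL i0|rewrite (leq_trans (leq_subr _ _))].
Qed.

Lemma trunc_deriv N f i : (i < N)%N -> (trunc N.+1 f)^`()`_i = i.+1%:R * f i.+1.
Proof. by move=> iN; rewrite coef_deriv coef_poly ltnS iN mulr_natl. Qed.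

Lemma coef_lt_exp N (p : {poly rat}) (f : series) j i :
  p = trunc N (sdrop0 f) -> (i < j)%N -> (p ^+ j)`_i = 0.
Proof.
move=> ->; elim: j i => // j IH i ij; rewrite exprS coefM big1 // => k _.
case: (posnP k) => [->|k0].
  by rewrite coef_poly /sdrop0 /= if_same mul0r.
have ki := ltn_ord k; rewrite IH ?mulr0 //; lia.
Qed.

Lemma slog_rec f : f 0%N = 1 ->
  forall n, n%:R * f n = smul (fun d => d%:R * slog f d) f n.
Proof.
move=> f0 [|n]; first by rewrite mul0r smul0 !mul0r.
set N := n.+1.
pose p := trunc N.+1 (sdrop0 f).
pose L : {poly rat} := \sum_(1 <= j < N.+1) ((-1) ^+ j.+1 / j%:R) *: p ^+ j.
have LE d : (d < N.+1)%N -> slog f d = L`_d.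
  move=> dN; rewrite /slog coef_sum [RHS](big_cat_nat (n := d.+1)) //=.
  rewrite [X in _ = _ + X]big_nat [X in _ = _ + X]big1 ?addr0 => [|j /andP[dj _]]; last first.
    by rewrite coefZ (@coef_lt_exp N.+1 _ f) // mulr0.
  by apply: eq_bigr => j _; rewrite coefZ (@spowE N.+1).
(* The derivative of the truncated logarithm is a geometric sum in [- p], which [1 + p] telescopes;
   the error [(- p) ^+ N] starts in degree [N]. *)
have dp : p^`() * (1 - (- p) ^+ N) = L^`() * (1 + p).
  have -> : L^`() = p^`() * \sum_(j < N) (- p) ^+ j.
    rewrite /L big_add1 big_mkord (big_morph _ (@derivD _) (deriv0 _)) mulr_sumr.
    apply: eq_bigr => j _; rewrite derivZ deriv_exp -[- p]scaleN1r exprZn -scalerAr -scaler_nat scalerA.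
    congr (_ *: _); rewrite !exprS !mulrA mulrNN !mul1r divfK //.
    by rewrite pnatr_eq0.
  rewrite -mulrA; congr (_ * _).
  by rewrite -opprB subrX1 -mulNr opprB opprK mulrC.
have pf i : (i < N)%N -> p^`()`_i = i.+1%:R * f i.+1.
  by move=> iN; rewrite trunc_deriv.
rewrite -pf //.
have -> : p^`()`_n = (p^`() * (1 - (- p) ^+ N))`_n.
  rewrite mulrBr mulr1 coefB -scaleN1r exprZn -scalerAr coefZ.
  rewrite (@eqlow_mul N p^`() p^`() (p ^+ N) 0) // ?mulr0 ?coef0 ?mulr0 ?subr0 //.
  by move=> i iN; rewrite coef0 (@coef_lt_exp N.+1 _ f).
rewrite dp coefM /smul [RHS]big_ord_recl !mul0r add0r.
apply: eq_bigr => i _; rewrite lift0 coef_deriv -LE ?ltnS ?leq_ord // mulr_natl; congr (_ * _).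
rewrite coefD coef1 coef_poly /sdrop0 subSS.
case: (n - i)%N (leq_subr i n) => [|k] kn /=; first by rewrite f0 addr0.
by rewrite add0r !ltnS ltnW.
Qed.

Lemma sexp0 h : sexp h 0%N = 1.
Proof. by rewrite /sexp big_ord_recl big_ord0 addr0 /= /sone fact0 divr1. Qed.

(** The truncated exponential [E N.+1] has derivative [p'] times [E N], and the missing term starts
    in degree [N]. The constant term of [h], dropped by [sexp], is killed by the factor [d] as
    well. *)
Lemma logder_sexp h : logder (sexp h) (fun d => d%:R * h d).
Proof.
move=> [|n]; first by rewrite mul0r smul0 !mul0r.
set N := n.+1.
pose p := trunc N.+1 (sdrop0 h).
pose E M : {poly rat} := \sum_(j < M) (j`!)%:R^-1 *: p ^+ j.
have EE d : (d < N.+1)%N -> sexp h d = (E N.+1)`_d.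
  move=> dN; rewrite /sexp /E coef_sum.
  rewrite -(big_mkord xpredT (fun j => spow (sdrop0 h) j d / (j`!)%:R)).
  rewrite -(big_mkord xpredT (fun j => ((j`!)%:R^-1 *: p ^+ j)`_d)).
  rewrite [RHS](big_cat_nat (n := d.+1)) //=.
  rewrite [X in _ = _ + X]big_nat [X in _ = _ + X]big1 ?addr0 => [|j /andP[dj _]]; last first.
    by rewrite coefZ (@coef_lt_exp N.+1 _ h) // mulr0.
  by apply: eq_bigr => j _; rewrite coefZ (@spowE N.+1) // mulrC.
have dE : (E N.+1)^`() = p^`() * E N.
  rewrite /E big_ord_recl derivD expr0 derivZ derivC scaler0 add0r.
  rewrite (big_morph _ (@derivD _) (deriv0 _)) mulr_sumr; apply: eq_bigr => j _.
  rewrite derivZ deriv_exp -scalerAr -scaler_nat scalerA; congr (_ *: _).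
  by rewrite factS natrM invfM mulrAC mulVf ?mul1r ?pnatr_eq0.
rewrite EE // mulr_natl -coef_deriv dE.
have -> : (p^`() * E N)`_n = (p^`() * E N.+1)`_n.
  apply: (@eqlow_mul N) => // i iN.
  have -> : E N.+1 = E N + (N`!)%:R^-1 *: p ^+ N by rewrite {1}/E big_ord_recr.
  rewrite coefD coefZ (@coef_lt_exp N.+1 _ h) //.
  by rewrite mulr0 addr0.
rewrite coefM /smul [RHS]big_ord_recl !mul0r add0r.
apply: eq_bigr => i _; rewrite lift0 trunc_deriv // -EE //.
by rewrite ltnS (leq_trans (leq_subr _ _)).
Qed.

(** * The logarithmic derivative of the truncated product *)

Section PartialProduct.
Variable k : nat.

Lemma logder_partial_prod M : logder (partial_prod k M)
  (fun d => - \sum_(t : k.-tuple 'I_M)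
     (#|lab (map val t)| * #|box (map val t)| *
       ((0 < d) && (#|box (map val t)| %| d)))%N%:R).
Proof.
have bx (r : {ffun 'I_k -> 'I_M}) :
    #|box (map val (tuple_of_finfun r))| = (\prod_(i < k) (r i).+1)%N.
  rewrite card_box size_map size_tuple; apply: eq_bigr => i _.
  by rewrite (nth_map (r i)) ?size_tuple // -tnth_nth tnth_mktuple.
have lb (r : {ffun 'I_k -> 'I_M}) :
    #|lab (map val (tuple_of_finfun r))| = (\prod_(i < k) (r i).+1 ^ i)%N.
  rewrite card_lab size_map size_tuple; apply: eq_bigr => i _.
  by rewrite (nth_map (r i)) ?size_tuple // -tnth_nth tnth_mktuple.
have -> : (fun d => - \sum_(t : k.-tuple 'I_M) (#|lab (map val t)| * #|box (map val t)| *
       ((0 < d) && (#|box (map val t)| %| d)))%N%:R) =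
   (fun d => \sum_(r : {ffun 'I_k -> 'I_M}) (\prod_(i < k) (r i).+1 ^ i)%N%:R *
     - ((\prod_(i < k) (r i).+1)%N%:R *+ ((0 < d) && (\prod_(i < k) (r i).+1 %| d))%N)) :> series.
  apply: functional_extensionality => d.
  rewrite -sumrN (reindex (@tuple_of_finfun _ k)); last first.
    exists (@finfun_of_tuple _ k) => ? _; [exact: tuple_of_finfunK|exact: finfun_of_tupleK].
  apply: eq_bigr => r _; rewrite bx lb !natrM mulrN; congr (- _).
  by rewrite -mulrA mulr_natr.
apply: logder_prod => r; apply: logder_spow; apply: logder_one_minus.
by rewrite -bx card_box_gt0.
Qed.

(** If the product of the [r_i] divides a positive [d <= M], then every [r_i <= M], so the
    truncation misses no term up to degree [M]. *)
Lemma partial_prod_rec M n : (n <= M)%N ->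
  n%:R * partial_prod k M n = smul (fun d => - (nsub k.+1 d)%:R) (partial_prod k M) n.
Proof.
move=> nM; rewrite logder_partial_prod; apply: eq_bigr => d _.
congr (- _ * _); rewrite -natr_sum; congr _%:R.
case: (posnP d) => [->|d0]; first by rewrite nsub0 big1 // => t _; rewrite muln0.
rewrite -(@sum_lab_dvd k M) //; last by rewrite (leq_trans _ nM) // -ltnS.
by rewrite [RHS]big_mkcond; apply: eq_bigr => t _; case: ifP; rewrite ?muln1 ?muln0.
Qed.

Lemma partial_prod0 M : partial_prod k M 0%N = 1.
Proof.
rewrite /partial_prod (big_morph (fun f : series => f 0%N) (id1 := 1) (op1 := *%R)) //; last first.
  by move=> f g; apply: smul0.
rewrite big1 // => r _; elim: (X in spow _ X) => // j IH.
rewrite /= smul0 IH mulr1 /one_minus_tpow (ltn_eqF (prodn_gt0 _)) //.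
Qed.

Lemma partial_prod_stable M N : (N <= M)%N -> partial_prod k M N = partial_prod k N N.
Proof.
move=> NM; apply: (@logder_unique N _ _ (fun d => - (nsub k.+1 d)%:R)
  (fun d => - (nsub k.+1 d)%:R)) => //.
- by rewrite !partial_prod0.
- by move=> n nN; apply: partial_prod_rec; apply: leq_trans NM.
- by move=> n nN; apply: partial_prod_rec.
- by rewrite nsub0 oppr0.
Qed.

End PartialProduct.

(** * Rational powers and comparison of the two series *)

Lemma logder_fpow c f l : f 0%N = 1 -> l 0%N = 0 -> logder f l ->
  logder (fpow c f) (fun d => c * l d).
Proof.
move=> f0 l0 fl n; rewrite logder_sexp; congr (smul _ _ n).
apply: functional_extensionality => d; rewrite mulrCA; congr (_ * _).
(* Since [f 0 = 1], comparing coefficients in [l f] and [t (log f)' f] yields [l d = d * slog f d]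
   from the smaller indices. *)
elim/ltn_ind: d => -[|d] IH; first by rewrite mul0r l0.
have := slog_rec f0 d.+1; rewrite fl /smul big_ord_recr [RHS]big_ord_recr /= subnn f0 !mulr1.
rewrite (eq_bigr (fun i : 'I_d.+1 => i%:R * slog f i * f (d.+1 - i)%N)) => [/addrI -> //|i _].
by rewrite IH.
Qed.

Theorem theorem3 (gT : finGroupType) (k : nat) (hk : (0 < k)%N) :
  exists P : series,
    (* P is the t-adic limit of the partial products over r_i <= M *)
    (forall N : nat, exists M0 : nat, forall M : nat, (M0 <= M)%N ->
        partial_prod k M N = P N) /\
    (forall N : nat, lhs_series gT k N = fpow (- chiG gT k) P N).
Proof.
(* The coefficient of [t^n] is stable from the bound [n] on, so the limit is read off the
   diagonal. *)
pose P : series := fun n => partial_prod k n n.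
have lP : logder P (fun d => - (nsub k.+1 d)%:R).
  move=> n; rewrite /P partial_prod_rec //; apply: eq_bigr => i _.
  by rewrite partial_prod_stable ?leq_subr.
have P0 : P 0%N = 1 by apply: partial_prod0.
exists P; split=> [N|N]; first by exists N => M; apply: partial_prod_stable.
have lF := @logder_fpow (- chiG gT k) P _ P0 _ lP.
(* Both sides have constant term 1, and the two minus signs cancel in the logarithmic derivative. *)
apply: (@logder_unique N _ _ (fun d => chiG gT k * (nsub k.+1 d)%:R)
  (fun d => - chiG gT k * - (nsub k.+1 d)%:R)) => //.
- by rewrite lhs_seriesE chiGn0 /fpow sexp0.
- by move=> n _; apply: lhs_series_rec.
- by move=> n _; apply: lF; rewrite nsub0 oppr0.
- by rewrite nsub0 mulr0.
- by move=> n _; rewrite mulrNN.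
Qed.
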